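(* Let $\mu_1,\mu_2,\mu_3>0$, $Q_*>0$, $$\phi=\frac{\mu_3(\mu_1+\mu_2)}{2\mu_1\mu_2},\qquad \lambda_3=1+\phi+\sqrt{\phi^2+2\phi},\qquad \lambda_4=1/\lambda_3,\qquad \Theta=\tfrac12(\lambda_3-1)Q_*.$$ Let $G_0=\tfrac12\mu_3Q_*^2$ and $G=\dfrac{2\mu_1\mu_2}{\mu_1+\mu_2}\Theta^2$. Then $$G_0=\frac{\mu_3(1-\lambda_4)^2}{2\phi^2}\Theta^2,\qquad \frac{G_0}{G}=\lambda_4,$$ and, as a function of $\phi\in(0,\infty)$, $G_0/G$ is monotonically decreasing with $G_0/G\to1$ as $\phi\to0$ and $G_0/G\to0$ as $\phi\to\infty$.
   Context: Setting: quasi-static splitting of a strip of two mass-spring chains with spring stiffnesses $\mu_1,\mu_2$, connected by bonds of stiffness $\mu_3$ with limiting strain $Q_*$. $\Theta$ is the critical external action (half the difference of the strains applied to the separated chains), $G_0$ is the strain energy of a connecting bond at breakage, and $G$ is the global (macrolevel) energy release per bond. *)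

(* Defs.v *)
From Stdlib Require Import Reals.
From Coquelicot Require Import Coquelicot.
Open Scope R_scope.

Definition phi (mu1 mu2 mu3 : R) : R :=
  mu3 * (mu1 + mu2) / (2 * mu1 * mu2).

Definition lambda3 (p : R) : R := 1 + p + sqrt (p ^ 2 + 2 * p).

Definition lambda4 (p : R) : R := 1 / lambda3 p.

(* Critical external action, for the limiting bond strain [Q]. *)
Definition Theta (mu1 mu2 mu3 Q : R) : R :=
  1 / 2 * (lambda3 (phi mu1 mu2 mu3) - 1) * Q.

(* Strain energy of a connecting bond at breakage. *)
Definition G0 (mu3 Q : R) : R := 1 / 2 * mu3 * Q ^ 2.

(* Global (macrolevel) energy release per bond. *)
Definition G (mu1 mu2 mu3 Q : R) : R :=
  2 * mu1 * mu2 / (mu1 + mu2) * Theta mu1 mu2 mu3 Q ^ 2.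

(* Main.v *)
Require Import Defs.
From Stdlib Require Import Reals Lra Psatz.
From Coquelicot Require Import Coquelicot.
Open Scope R_scope.

(** [lambda3 p] is a root of [(z - 1)^2 = 2 p z]; this quadratic relation turns
    both energy identities into identities of rational functions. *)

(** Write [L] for [lambda3 p]. By [lambda3_quadratic], [Theta ^ 2] equals [p * L * Q ^ 2 / 2], and
    inserting [phi] gives [G = L * G0], so the ratio is [1 / L]. The remaining claims concern [L]
    alone: it increases with [p], tends to 1 at 0, and exceeds [1 + p] ([lambda3_gt]), which also
    keeps the denominators nonzero. *)

Lemma lambda3_gt (p : R) : 0 < p -> 1 + p < lambda3 p.
Proof.
intros hp; unfold lambda3.
assert (0 < sqrt (p ^ 2 + 2 * p)) by (apply sqrt_lt_R0; nra).
lra.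
Qed.

Lemma lambda3_quadratic (p : R) :
  0 < p -> (lambda3 p - 1) ^ 2 = 2 * p * lambda3 p.
Proof.
intros hp; unfold lambda3.
assert (h : sqrt (p ^ 2 + 2 * p) ^ 2 = p ^ 2 + 2 * p) by (apply pow2_sqrt; nra).
(* With [s] the square root, [(p + s)^2 = p^2 + 2ps + s^2 = 2p(1 + p + s)]. *)
nra.
Qed.

Lemma phi_gt0 (mu1 mu2 mu3 : R) :
  0 < mu1 -> 0 < mu2 -> 0 < mu3 -> 0 < phi mu1 mu2 mu3.
Proof.
intros h1 h2 h3; unfold phi.
apply Rdiv_lt_0_compat; repeat apply Rmult_lt_0_compat; lra.
Qed.

Lemma G0_Theta (mu1 mu2 mu3 Q : R) :
  0 < mu1 -> 0 < mu2 -> 0 < mu3 ->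
  let p := phi mu1 mu2 mu3 in
  G0 mu3 Q = mu3 * (1 - lambda4 p) ^ 2 / (2 * p ^ 2) * Theta mu1 mu2 mu3 Q ^ 2.
Proof.
intros h1 h2 h3 p.
pose proof (phi_gt0 _ _ _ h1 h2 h3) as hp; fold p in hp.
pose proof (lambda3_gt _ hp) as hL.
pose proof (lambda3_quadratic _ hp) as hq.
unfold G0, Theta, lambda4; fold p.
set (L := lambda3 p) in *.
(* Since [1 - 1 / L = (L - 1) / L], the two squares combine into [((L - 1) ^ 2) ^ 2], which [hq]
   turns into [4 * (p * L) ^ 2]. *)
replace (mu3 * (1 - 1 / L) ^ 2 / (2 * p ^ 2) * (1 / 2 * (L - 1) * Q) ^ 2)
  with (mu3 * Q ^ 2 / 8 * ((L - 1) ^ 2) ^ 2 / (p * L) ^ 2) by (field; lra).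
rewrite hq; field; lra.
Qed.

Lemma G0_over_G (mu1 mu2 mu3 Q : R) :
  0 < mu1 -> 0 < mu2 -> 0 < mu3 -> 0 < Q ->
  G0 mu3 Q / G mu1 mu2 mu3 Q = lambda4 (phi mu1 mu2 mu3).
Proof.
intros h1 h2 h3 hQ.
pose proof (phi_gt0 _ _ _ h1 h2 h3) as hp.
pose proof (lambda3_gt _ hp) as hL.
pose proof (lambda3_quadratic _ hp) as hq.
unfold G0, G, Theta, lambda4.
set (L := lambda3 _) in *.
replace ((1 / 2 * (L - 1) * Q) ^ 2) with (Q ^ 2 / 4 * (L - 1) ^ 2) by field.
(* [L] stays opaque: only the factor [phi] produced by [hq] is expanded, and it cancels the
   stiffness prefactor of [G]. *)
rewrite hq; unfold phi; field; lra.
Qed.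

Lemma lambda4_decreasing (x y : R) : 0 < x -> x < y -> lambda4 y < lambda4 x.
Proof.
intros hx hxy.
assert (hy : 0 < y) by lra.
pose proof (lambda3_gt _ hx); pose proof (lambda3_gt _ hy).
assert (sqrt (x ^ 2 + 2 * x) < sqrt (y ^ 2 + 2 * y)) by (apply sqrt_lt_1_alt; nra).
unfold lambda4, Rdiv; rewrite 2!Rmult_1_l.
apply Rinv_lt_contravar; [nra | unfold lambda3; lra].
Qed.

Lemma lambda3_0 : lambda3 0 = 1.
Proof.
unfold lambda3; replace (0 ^ 2 + 2 * 0) with 0 by ring.
rewrite sqrt_0; ring.
Qed.

(** The formula is continuous at 0 even from both sides, because [sqrt] is 0 on negative arguments;
    the one-sided limit is then the value at 0. *)
Lemma lambda4_lim_0 : filterlim lambda4 (at_right 0) (locally 1).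
Proof.
apply filterlim_filter_le_1 with (1 := filter_le_within (F := locally 0) _).
replace 1 with (lambda4 0) by (unfold lambda4; rewrite lambda3_0; field).
apply (proj1 (continuity_pt_filterlim lambda4 0)).
unfold lambda4; apply continuity_pt_div.
- apply continuity_pt_const; intros ? ?; reflexivity.
- unfold lambda3; apply continuity_pt_plus.
  + apply derivable_continuous_pt; reg.
  + apply (continuity_pt_comp (fun p => p ^ 2 + 2 * p) sqrt).
    * apply derivable_continuous_pt; reg.
    * apply continuity_pt_sqrt; lra.
- rewrite lambda3_0; lra.
Qed.

Lemma lambda4_lim_infty : is_lim lambda4 p_infty 0.
Proof.
(* Squeeze: [lambda3 p > 1 + p > p] bounds [lambda4 p] by [/ p]. *)
apply (is_lim_le_le_loc (fun _ => 0) (fun p => / p)).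
- exists 0; intros p hp.
  pose proof (lambda3_gt _ hp).
  unfold lambda4, Rdiv; rewrite Rmult_1_l; split.
  + left; apply Rinv_0_lt_compat; lra.
  + apply Rinv_le_contravar; lra.
- apply is_lim_const.
- apply (is_lim_inv (fun p => p) p_infty p_infty); [apply is_lim_id | discriminate].
Qed.

(* In the second conjunct, [r] is G0/G regarded as a function of phi. Since phi
   takes every positive value, [r] is uniquely determined on (0, +oo). *)
Theorem mainTheorem8 :
  (forall mu1 mu2 mu3 Q : R, 0 < mu1 -> 0 < mu2 -> 0 < mu3 -> 0 < Q ->
     let p := phi mu1 mu2 mu3 in
     G0 mu3 Q =
       mu3 * (1 - lambda4 p) ^ 2 / (2 * p ^ 2) * Theta mu1 mu2 mu3 Q ^ 2 /\
     G0 mu3 Q / G mu1 mu2 mu3 Q = lambda4 p) /\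
  (exists r : R -> R,
     (forall mu1 mu2 mu3 Q : R, 0 < mu1 -> 0 < mu2 -> 0 < mu3 -> 0 < Q ->
        G0 mu3 Q / G mu1 mu2 mu3 Q = r (phi mu1 mu2 mu3)) /\
     (forall x y : R, 0 < x -> x < y -> r y < r x) /\
     filterlim r (at_right 0) (locally 1) /\
     is_lim r p_infty 0).
Proof.
split.
- intros mu1 mu2 mu3 Q h1 h2 h3 hQ p; split.
  + now apply G0_Theta.
  + now apply G0_over_G.
- exists lambda4; split; [exact G0_over_G | split; [exact lambda4_decreasing |]].
  split; [exact lambda4_lim_0 | exact lambda4_lim_infty].
Qed.
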